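(* Let $p$ and $\bar{p}$ be $\mathrm{CSP}_p$ processes with $p \approx_{\mathcal{O}} \bar{p}$. Then for every $\mathrm{CSP}_p$ context $C[\cdot]$ it holds that $C[p] \approx_{\mathcal{O}} C[\bar{p}]$; that is, $\approx_{\mathcal{O}}$ is a congruence for the operators of $\mathrm{CSP}_p$.
   Context: Fix a finite set of actions $\mathcal{A}$. A probabilistic transition system (PTS) is a tuple $(S_n,S_p,\rightarrow,\dashrightarrow)$ where $S_n,S_p$ are finite disjoint sets of nondeterministic and probabilistic states; $\rightarrow\ \subseteq S_n\times\mathcal{A}\times(S_n\cup S_p)$ is an action transition relation such that $(s,a,t),(s,a,t')\in\rightarrow$ implies $t=t'$; and $\dashrightarrow\ \subseteq S_p\times(0,1]\times S_n$ is a probabilistic transition relation with $\sum_{(s,\pi,t)\in\dashrightarrow}\pi=1$ for every $s\in S_p$. A state with no outgoing transitions belongs to $S_n$. Write $s\xrightarrow{a}t$ and $s\overset{\pi}{\dashrightarrow}t$. A process is a state together with all states reachable from it and the transitions between them. For $s\in S_n$, its menu is $I(s)=\{a\in\mathcal{A}: s\xrightarrow{a}t \text{ for some } t\}$. Given a process $s$, a set $M\subseteq\mathcal{A}$ and $a\in M$ such that $I(s)=M$ if $s\in S_n$, or otherwise there is $s\overset{}{\dashrightarrow}s'$ with $I(s')=M$, the process $s_{(M,a)}$ is defined as follows: if $s\in S_n$, its root is the state $s'$ with $s\xrightarrow{a}s'$; if $s\in S_p$, a new root state is created; let $\pi=\sum\{\pi_i : s\overset{\pi_i}{\dashrightarrow}s_i,\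 I(s_i)=M\}$; for every $s_i'$ with $s\overset{\pi_i}{\dashrightarrow}s_i\xrightarrow{a}s_i'$ and $I(s_i)=M$: if $s_i'$ has no probabilistic transitions, add an edge from the new root to $s_i'$ with probability $\pi_i/\pi$; and for every $s_i'\overset{\rho}{\dashrightarrow}s_i''$, add an edge from the new root to $s_i''$ with probability $\pi_i\rho/\pi$. A ready trace of length $n$ is a sequence $(M_1,a_1,M_2,\dots,M_{n-1},a_{n-1},M_n)$ with $M_i\subseteq\mathcal{A}$ and $a_i\in M_i$. For a process $s$ and $M\subseteq\mathcal{A}$: $P^1_s(M)=\sum_{s\overset{\pi}{\dashrightarrow}s'}\pi\cdot P^1_{s'}(M)$ if $s\in S_p$; $P^1_s(M)=1$ if $s\in S_n$ and $I(s)=M$; $P^1_s(M)=0$ otherwise. For $n>1$: if $P^1_s(M_1)>0$ then $P^2_s(M_2\mid M_1,a_1)=P^1_{s_{(M_1,a_1)}}(M_2)$ and, for $n>2$, $P^n_s(M_n\mid M_1,a_1,\dots,M_{n-1},a_{n-1})=P^{n-1}_{s_{(M_1,a_1)}}(M_n\mid M_2,a_2,\dots,M_{n-1},a_{n-1})$; if $P^1_s(M_1)=0$ these are undefined. Two processes $s,\bar s$ are probabilistically ready trace equivalent, $s\approx_{\mathcal{O}}\bar s$, iff $P^1_s(M)=P^1_{\bar s}(M)$ for all $M\subseteq\mathcal{A}$, and for every $n>1$ and every ready trace, $P^n_s(M_n\mid M_1,a_1,\dots,a_{n-1})$ is defined iff $P^n_{\bar s}(M_n\mid M_1,a_1,\dots,a_{n-1})$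 is defined, and then they are equal. $\mathrm{CSP}_p$ processes are generated by $P ::= \delta \mid \sum_{i\in I}a_i.P_i \mid \bigoplus_{i\in I}\pi_iP_i \mid \Theta P \mid P\parallel P \mid P\parallel_L P$, where $\{a_i\}_{i\in I}\subseteq\mathcal{A}$ are pairwise distinct, $\pi_i\in(0,1]$ with $\sum_i\pi_i=1$, and in $P\parallel_L P$ the set $L\subseteq\mathcal{A}$ is the set of actions appearing in both operands (and it is required that if $p,q$ share actions and $q,r$ share actions then $p,r$ share none). $\delta$ has no transitions; $a.p$ is a one-summand external choice and $a$ abbreviates $a.\delta$; $\Theta$ is a priority operator w.r.t. a fixed partial order $>$ on $\mathcal{A}$. The semantics is the PTS given by the rules (symmetric rules for $\parallel$ and $\parallel_L$ are included; ''$q\not\dashrightarrow$'' means $q$ has no probabilistic transition): $\sum_{i}a_i.p_i\xrightarrow{a_i}p_i$; if $p\xrightarrow{a}p'$ and $q\xrightarrow{a}q'$ then $p\parallel q\xrightarrow{a}p'\parallel q'$; if $p\overset{\pi}{\dashrightarrow}p'$, $q\overset{\rho}{\dashrightarrow}q'$ then $p\parallel q\overset{\pi\rho}{\dashrightarrow}p'\parallel q'$; if $p\overset{\pi}{\dashrightarrow}p'$, $q\not\dashrightarrow$ then $p\parallel q\overset{\pi}{\dashrightarrow}p'\parallel q$; if $p_k\not\dashrightarrow$ then $\bigoplus_i\pi_ip_i\overset{\pi_k}{\dashrightarrow}p_k$; if $p_k\overset{\rho_k}{\dashrightarrow}p_k'$ then $\bigoplus_i\pi_ip_i\overset{\pi_k\rho_k}{\dashrightarrow}p_k'$;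 if $a\notin L$, $p\xrightarrow{a}p'$, $q\not\dashrightarrow$ then $p\parallel_L q\xrightarrow{a}p'\parallel_L q$; if $a\in L$, $p\xrightarrow{a}p'$, $q\xrightarrow{a}q'$ then $p\parallel_L q\xrightarrow{a}p'\parallel_L q'$; if $p\overset{\pi}{\dashrightarrow}p'$, $q\not\dashrightarrow$ then $p\parallel_L q\overset{\pi}{\dashrightarrow}p'\parallel_L q$; if $p\overset{\pi}{\dashrightarrow}p'$, $q\overset{\rho}{\dashrightarrow}q'$ then $p\parallel_L q\overset{\pi\rho}{\dashrightarrow}p'\parallel_L q'$; if $p\xrightarrow{a}p'$ and $p$ has no transition $p\xrightarrow{b}$ with $a<b$ then $\Theta p\xrightarrow{a}\Theta p'$; if $p\overset{\pi}{\dashrightarrow}p'$ then $\Theta p\overset{\pi}{\dashrightarrow}\Theta p'$. A context $C[\cdot]$ is a $\mathrm{CSP}_p$ process with a hole; $C[p]$ is obtained by filling the hole with $p$. *)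

(* Defs.v *)
From Stdlib Require List.
From mathcomp Require Import all_boot all_order all_algebra.

Set Implicit Arguments.
Unset Strict Implicit.
Unset Printing Implicit Defensive.

Import Order.TTheory GRing.Theory Num.Theory.
Local Open Scope ring_scope.

(* Transitions are listed per source state.  Probabilistic transitions form a
   multiset: two derivations that give the same probability and the same target
   are two transitions and both contribute to sums of probabilities.  The
   partition into S_n and S_p needs no separate field: the probabilities leaving
   a state of S_p sum to 1, so S_p is the set of states that have a probabilistic
   transition.  The requirements on transitions are in [is_process], which holds
   of all CSP_p processes by [csp_is_process]. *)
Record pts (A : finType) (R : realFieldType) := Pts {
  state : Type;
  act   : state -> seq (A * state);
  prob  : state -> seq (R * state) }.

(* A process is represented by its root in an ambient transition system; all
   notions below only look at the part reachable from the root. *)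
Record process (A : finType) (R : realFieldType) := Process {
  carrier : pts A R;
  root    : state carrier }.

Section Processes.

Context {A : finType} {R : realFieldType}.
Implicit Types (T : pts A R) (M : {set A}) (a : A).

Definition nondet T (s : state T) : bool := nilp (prob s).

Definition menu T (s : state T) : {set A} := [set a | a \in unzip1 (act s)].

Inductive reachable T (s : state T) : state T -> Prop :=
| reach_refl : reachable s s
| reach_act t x : reachable s t -> List.In x (act t) -> reachable s x.2
| reach_prob t x : reachable s t -> List.In x (prob t) -> reachable s x.2.

Definition is_process (s : process A R) : Prop :=
  (exists l : seq (state (carrier s)),
     forall t, reachable (root s) t -> List.In t l) /\
  forall t, reachable (root s) t ->
    [/\ ~~ nondet t -> act t = [::],
        ~~ nondet t -> \sum_(x <- prob t) x.1 = 1,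
        all (fun x => (0 < x.1 <= 1) && nondet x.2) (prob t)
      & uniq (unzip1 (act t))].

(* The system extended with a new root [None]; [m] is the total probability of
   reaching the menu M from s. *)
Definition residual_pts T (s : state T) M a : pts A R :=
  let m := \sum_(x <- prob s | menu x.2 == M) x.1 in
  @Pts A R (option (state T))
    (fun u => if u is Some t then [seq (x.1, Some x.2) | x <- act t] else [::])
    (fun u => if u is Some t then [seq (x.1, Some x.2) | x <- prob t] else
       flatten [seq flatten [seq
           if nondet y.2 then [:: (x.1 / m, Some y.2)]
           else [seq (x.1 * z.1 / m, Some z.2) | z <- prob y.2]
         | y <- act x.2 & y.1 == a]
       | x <- prob s & menu x.2 == M]).

(* [None] when s_(M,a) is not defined. *)
Definition residual (s : process A R) M a : option (process A R) :=
  let r := root s in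
  if a \notin M then None
  else if nondet r then
    if menu r == M
    then ohead [seq Process y.2 | y <- act r & y.1 == a]
    else None
  else if has (fun x => menu x.2 == M) (prob r)
    then Some (@Process A R (residual_pts r M a) None)
    else None.

(* Since probabilistic transitions lead to nondeterministic states, one
   unfolding of the recursion for P^1 suffices. *)
Definition P1 (s : process A R) M : R :=
  let r := root s in
  if nondet r then (menu r == M)%:R
  else \sum_(x <- prob r) x.1 * (menu x.2 == M)%:R.

(* For h = [:: (M_1,a_1); ...; (M_(n-1),a_(n-1))], [Pn s h M] is
   P^n_s(M | M_1,a_1,...,M_(n-1),a_(n-1)), and [None] when that is undefined. *)
Fixpoint Pn (s : process A R) (h : seq ({set A} * A)) M : option R :=
  if h is x :: h' then
    if 0 < P1 s x.1
    then obind (fun s' => Pn s' h' M) (residual s x.1 x.2)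
    else None
  else Some (P1 s M).

Definition ready_trace (h : seq ({set A} * A)) : bool :=
  all (fun x : {set A} * A => x.2 \in x.1) h.

(* Equality in [option R]: one side is defined iff the other one is, and then
   the values agree. *)
Definition ready_equiv (s s' : process A R) : Prop :=
  forall h M, ready_trace h -> Pn s h M = Pn s' h M.

End Processes.

(* Raw terms; the side conditions of the grammar are in [csp_process]. *)
Inductive term (A : finType) (R : realFieldType) : Type :=
| Delta
| ExtChoice of seq (A * term A R)
| ProbChoice of seq (R * term A R)
| Theta of term A R
| Par of term A R & term A R
| HPar of {set A} & term A R & term A R.

Arguments Delta {A R}.

Section Syntax.

Context {A : finType} {R : realFieldType}.
Notation term := (term A R).

(* The actions that appear (syntactically) in a term. *)
Fixpoint actions (p : term) : {set A} :=
  match p with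
  | Delta => set0
  | ExtChoice s => foldr (fun x B => x.1 |: actions x.2 :|: B) set0 s
  | ProbChoice s => foldr (fun x B => actions x.2 :|: B) set0 s
  | Theta p => actions p
  | Par p q | HPar _ p q => actions p :|: actions q
  end.

(* The operands p_1, ..., p_n of a nested composition of the p_i by [HPar],
   irrespective of the bracketing. *)
Fixpoint operands (p : term) : seq term :=
  if p is HPar _ p q then operands p ++ operands q else [:: p].

Definition share (p q : term) : bool := actions p :&: actions q != set0.

(* For three distinct operands p, q, r: if p, q share actions and q, r share
   actions, then p, r share none.  Distinctness is that of the occurrences. *)
Definition no_triangle (s : seq term) : bool :=
  let op := nth Delta s in
  [forall i : 'I_(size s), forall j : 'I_(size s), forall k : 'I_(size s),
     [&& i != j, j != k & i != k] ==>
     share (op i) (op j) && share (op j) (op k) ==> ~~ share (op i) (op k)].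

Fixpoint csp_process (p : term) : bool :=
  match p with
  | Delta => true
  | ExtChoice s => uniq (unzip1 s) && all (fun x => csp_process x.2) s
  | ProbChoice s =>
      [&& all (fun x => 0 < x.1 <= 1) s, \sum_(x <- s) x.1 == 1
        & all (fun x => csp_process x.2) s]
  | Theta p => csp_process p
  | Par p q => csp_process p && csp_process q
  | HPar L p q =>
      [&& csp_process p, csp_process q, L == actions p :&: actions q
        & no_triangle (operands p ++ operands q)]
  end.

(* The set L of [HPar] belongs to the syntax of the context, so it does not
   depend on the process put into the hole. *)
Inductive context : Type :=
| Hole
| CExtChoice of seq (A * term) & A & context & seq (A * term)
| CProbChoice of seq (R * term) & R & context & seq (R * term)
| CTheta of context
| CParL of context & term
| CParR of term & context
| CHParL of {set A} & context & term
| CHParR of {set A} & term & context.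

Fixpoint fill (C : context) (p : term) : term :=
  match C with
  | Hole => p
  | CExtChoice s1 a C s2 => ExtChoice (s1 ++ (a, fill C p) :: s2)
  | CProbChoice s1 u C s2 => ProbChoice (s1 ++ (u, fill C p) :: s2)
  | CTheta C => Theta (fill C p)
  | CParL C q => Par (fill C p) q
  | CParR q C => Par q (fill C p)
  | CHParL L C q => HPar L (fill C p) q
  | CHParR L q C => HPar L q (fill C p)
  end.

End Syntax.

Arguments context : clear implicits.

(* [tprob p] and [tact p] list the transitions of p that the rules derive, one
   entry per derivation. *)

Section Semantics.

Context {d : Order.disp_t} {A : finPOrderType d} {R : realFieldType}.
Notation term := (term A R).

Definition par_prob (f : term -> term -> term)
    (p : term) (sp : seq (R * term)) (q : term) (sq : seq (R * term)) :=
  match sp, sq with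
  | [::], [::] => [::]
  | _, [::] => [seq (x.1, f x.2 q) | x <- sp]
  | [::], _ => [seq (y.1, f p y.2) | y <- sq]
  | _, _ => [seq (x.1 * y.1, f x.2 y.2) | x <- sp, y <- sq]
  end.

Fixpoint tprob (p : term) : seq (R * term) :=
  match p with
  | Delta | ExtChoice _ => [::]
  | ProbChoice s =>
      flatten [seq if nilp (tprob x.2) then [:: x]
                   else [seq (x.1 * y.1, y.2) | y <- tprob x.2] | x <- s]
  | Theta p => [seq (x.1, Theta x.2) | x <- tprob p]
  | Par p q => par_prob (@Par A R) p (tprob p) q (tprob q)
  | HPar L p q => par_prob (HPar L) p (tprob p) q (tprob q)
  end.

Fixpoint tact (p : term) : seq (A * term) :=
  match p with
  | Delta | ProbChoice _ => [::]
  | ExtChoice s => s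
  | Theta p => [seq (x.1, Theta x.2) | x <- tact p
                  & ~~ has (fun y => (x.1 < y.1)%O) (tact p)]
  | Par p q =>
      [seq (x.1, Par x.2 y.2) | x <- tact p, y <- [seq y <- tact q | y.1 == x.1]]
  | HPar L p q =>
      [seq (x.1, HPar L x.2 q) | x <- tact p & (x.1 \notin L) && nilp (tprob q)]
      ++ [seq (y.1, HPar L p y.2) | y <- tact q
            & (y.1 \notin L) && nilp (tprob p)]
      ++ [seq (x.1, HPar L x.2 y.2) | x <- [seq x <- tact p | x.1 \in L],
            y <- [seq y <- tact q | y.1 == x.1]]
  end.

Definition term_pts : pts A R := @Pts A R term tact tprob.

Definition proc (p : term) : process A R := @Process A R term_pts p.

End Semantics.

Section WellDefined.

Context {d : Order.disp_t} {A : finPOrderType d} {R : realFieldType}.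
Notation term := (term A R).

Lemma term_ind_all (P : term -> Prop) :
  P Delta ->
  (forall s, (forall x, List.In x s -> P x.2) -> P (ExtChoice s)) ->
  (forall s, (forall x, List.In x s -> P x.2) -> P (ProbChoice s)) ->
  (forall p, P p -> P (Theta p)) ->
  (forall p q, P p -> P q -> P (Par p q)) ->
  (forall L p q, P p -> P q -> P (HPar L p q)) ->
  forall p, P p.
Proof.
move=> P0 Pe Pp Pt Pa Ph; fix IH 1; case=> [|s|s|p|p q|L p q].
- exact: P0.
- by apply: Pe; elim: s => [x []|[a t] s IHs x /= [<-|]]; [exact: (IH t)|exact: IHs].
- by apply: Pp; elim: s => [x []|[a t] s IHs x /= [<-|]]; [exact: (IH t)|exact: IHs].
- exact: Pt.
- exact: Pa.
- exact: Ph.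
Qed.

Lemma allI T (a : pred T) s : (forall x, List.In x s -> a x) -> all a s.
Proof.
elim: s => //= x s IHs H; rewrite H /=; last by left.
by apply: IHs => y ys; apply: H; right.
Qed.

Lemma allE T (a : pred T) s x : all a s -> List.In x s -> a x.
Proof. by elim: s => //= y s IHs /andP[ay /IHs Hs] [<-|]. Qed.

Fixpoint tsize (p : term) : nat :=
  match p with
  | Delta => 0
  | ExtChoice s => (foldr (fun x n => tsize x.2 + n) 0 s).+1
  | ProbChoice s => (foldr (fun x n => tsize x.2 + n) 0 s).+1
  | Theta p => (tsize p).+1
  | Par p q | HPar _ p q => (tsize p + tsize q).+1
  end.

(* What remains of [csp_process] in the states reachable from a process. *)
Fixpoint reach_ok (p : term) : bool :=
  match p with
  | Delta => true
  | ExtChoice s => uniq (unzip1 s) && all (fun x => reach_ok x.2) s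
  | ProbChoice s =>
      [&& all (fun x => 0 < x.1 <= 1) s, \sum_(x <- s) x.1 == 1
        & all (fun x => reach_ok x.2) s]
  | Theta p => reach_ok p
  | Par p q => reach_ok p && reach_ok q
  | HPar L p q => [&& reach_ok p, reach_ok q & actions p :&: actions q \subset L]
  end.

Lemma csp_inv (p : term) : csp_process p -> reach_ok p.
Proof.
elim/term_ind_all: p => //=.
- move=> s IH /andP[-> /= H]; apply: allI => x xs; apply: IH => //.
  exact: allE H xs.
- move=> s IH /and3P[-> -> /= H]; apply: allI => x xs; apply: IH => //.
  exact: allE H xs.
- by move=> p q IHp IHq /andP[/IHp -> /IHq ->].
- by move=> L p q IHp IHq /and4P[/IHp -> /IHq -> /eqP -> _] /=.
Qed.

Definition smaller (q p : term) : bool :=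
  [&& actions q \subset actions p, (tsize q < tsize p)%N & reach_ok q].

Lemma tsize_mem B (s : seq (B * term)) x : List.In x s ->
  (tsize x.2 <= foldr (fun x n => tsize x.2 + n) 0 s)%N.
Proof.
elim: s => //= y s IHs [<-|/IHs H]; first exact: leq_addr.
exact: leq_trans H (leq_addl _ _).
Qed.

Lemma actions_memE (s : seq (A * term)) x : List.In x s ->
  (x.1 \in actions (ExtChoice s)) && (actions x.2 \subset actions (ExtChoice s)).
Proof.
elim: s => //= y s IHs [<-|/IHs/andP[H1 H2]].
  by rewrite !inE eqxx /= -setUA setUCA subsetUl.
by rewrite !inE H1 !orbT /= subsetU // H2 orbT.
Qed.

Lemma actions_memP (s : seq (R * term)) x : List.In x s ->
  actions x.2 \subset actions (ProbChoice s).
Proof.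
elim: s => //= y s IHs [<-|/IHs H]; first exact: subsetUl.
by rewrite subsetU // H orbT.
Qed.

Lemma smallerS (q p p' : term) : smaller q p ->
  actions p \subset actions p' -> (tsize p <= tsize p')%N -> smaller q p'.
Proof.
case/and3P=> H1 H2 H5 H3 H4.
by rewrite /smaller H5 (subset_trans H1 H3) (leq_trans H2 H4).
Qed.

Lemma smaller_Theta q p : smaller q p -> smaller (Theta q) (Theta p).
Proof. by []. Qed.

Lemma smaller_Par q1 q2 p1 p2 : reach_ok (Par p1 p2) ->
    [|| smaller q1 p1 && smaller q2 p2,
        smaller q1 p1 && [&& actions q2 \subset actions p2, (tsize q2 <= tsize p2)%N & reach_ok q2] |
        [&& actions q1 \subset actions p1, (tsize q1 <= tsize p1)%N & reach_ok q1] && smaller q2 p2] ->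
  smaller (Par q1 q2) (Par p1 p2).
Proof.
rewrite /smaller /= ltnS => _ /or3P[]; case/andP=> /and3P[A1 B1 ->] /and3P[A2 B2 ->];
  rewrite setUSS //= andbT.
- by rewrite -addSn leq_add // ltnW.
- by rewrite -addSn leq_add.
- by rewrite -addnS leq_add.
Qed.

Lemma smaller_HPar L q1 q2 p1 p2 : reach_ok (HPar L p1 p2) ->
    [|| smaller q1 p1 && smaller q2 p2,
        smaller q1 p1 && [&& actions q2 \subset actions p2, (tsize q2 <= tsize p2)%N & reach_ok q2] |
        [&& actions q1 \subset actions p1, (tsize q1 <= tsize p1)%N & reach_ok q1] && smaller q2 p2] ->
  smaller (HPar L q1 q2) (HPar L p1 p2).
Proof.
rewrite /smaller /= ltnS => /and3P[_ _ sL].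
move=> /or3P[]; case/andP=> /and3P[A1 B1 ->] /and3P[A2 B2 ->];
  rewrite setUSS //= (subset_trans (setISS A1 A2) sL) andbT.
- by rewrite -addSn leq_add // ltnW.
- by rewrite -addSn leq_add.
- by rewrite -addnS leq_add.
Qed.

Definition good_step p (x : R * term) :=
  [&& 0 < x.1 <= 1, nilp (tprob x.2) & smaller x.2 p].

Lemma par_prob_cons f (p q : term) sp sq : par_prob f p sp q sq =
  if nilp sp && nilp sq then [::] else
  [seq (x.1 * y.1, f x.2 y.2) | x <- (if nilp sp then [:: (1, p)] else sp),
                                y <- (if nilp sq then [:: (1, q)] else sq)].
Proof.
case: sp sq => [|x sp] [|y sq] //=.
  by rewrite cats0 mul1r; congr (_ :: _); apply: eq_map => z; rewrite mul1r.
rewrite mulr1; congr (_ :: _); elim: sp => //= z s ->.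
by rewrite mulr1.
Qed.

Lemma nilp_par_prob f (p q : term) sp sq :
  nilp (par_prob f p sp q sq) = nilp sp && nilp sq.
Proof. by case: sp sq => [|x sp] [|y sq]. Qed.

Lemma sum_allpairs (f : term -> term -> term) (sp sq : seq (R * term)) :
  \sum_(z <- [seq (x.1 * y.1, f x.2 y.2) | x <- sp, y <- sq]) z.1 =
  (\sum_(x <- sp) x.1) * (\sum_(y <- sq) y.1).
Proof.
rewrite big_allpairs_dep mulr_suml; apply: eq_bigr => x _.
by rewrite mulr_sumr.
Qed.

Lemma In_map T U (f : T -> U) s y :
  List.In y (map f s) -> exists2 x, List.In x s & y = f x.
Proof.
elim: s => //= x s IHs [<-|/IHs[z zs ->]]; first by exists x; [left|].
by exists z; [right|].
Qed.

Lemma In_cat T (s1 s2 : seq T) y :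
  List.In y (s1 ++ s2) -> List.In y s1 \/ List.In y s2.
Proof. by elim: s1 => /= [|x s IHs]; [right|case=> [|/IHs[]]; tauto]. Qed.

Lemma In_filter T (a : pred T) s y :
  List.In y (filter a s) -> List.In y s /\ a y.
Proof.
elim: s => //= x s IHs; case: ifP => [ax|_ /IHs]; last by tauto.
by case=> [<-|/IHs]; tauto.
Qed.

Lemma In_flatten T (ss : seq (seq T)) y :
  List.In y (flatten ss) -> exists2 s, List.In s ss & List.In y s.
Proof.
elim: ss => [|s ss IHs] /=; first by [].
move=> H; have {}H : List.In y (s ++ flatten ss) := H.
case: (In_cat H) => {H} [ys|H]; first by exists s; [left|].
by have [t ts yt] := IHs H; exists t; [right|].
Qed.

Lemma In_allpairs T U V (f : T -> U -> V) s (t : T -> seq U) z :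
  List.In z [seq f x y | x <- s, y <- t x] ->
  exists x y, [/\ List.In x s, List.In y (t x) & z = f x y].
Proof.
move=> H; have [u Hu zu] := In_flatten H; have [x xs Eu] := In_map Hu.
by rewrite Eu in zu; have [y ys ->] := In_map zu; exists x, y.
Qed.

Lemma good_par f (p q : term) : reach_ok p -> reach_ok q ->
  (forall q1 q2, nilp (tprob q1) -> nilp (tprob q2) ->
    nilp (tprob (f q1 q2))) ->
  (forall q1 q2,
    [|| smaller q1 p && smaller q2 q,
        smaller q1 p && [&& actions q2 \subset actions q, (tsize q2 <= tsize q)%N & reach_ok q2] |
        [&& actions q1 \subset actions p, (tsize q1 <= tsize p)%N & reach_ok q1] && smaller q2 q] ->
    smaller (f q1 q2) (f p q)) ->
  all (good_step p) (tprob p) -> all (good_step q) (tprob q) ->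
  all (good_step (f p q)) (par_prob f p (tprob p) q (tprob q)).
Proof.
move=> ip iq fn fs gp gq; apply: allI => z.
rewrite par_prob_cons; case: ifP => // N H.
have [x [y [xs ys ->]]] := In_allpairs H.
have gx : [/\ 0 < x.1 <= 1, nilp (tprob x.2) & smaller x.2 p || [&& nilp (tprob p), actions x.2 \subset actions p, (tsize x.2 <= tsize p)%N & reach_ok x.2]].
  case: ifP xs => [np [<-|//]|_ /(allE gp)/and3P[-> -> ->]] //=.
  by rewrite ltr01 lexx np subxx leqnn ip orbT.
have gy : [/\ 0 < y.1 <= 1, nilp (tprob y.2) & smaller y.2 q || [&& nilp (tprob q), actions y.2 \subset actions q, (tsize y.2 <= tsize q)%N & reach_ok y.2]].
  case: ifP ys => [np [<-|//]|_ /(allE gq)/and3P[-> -> ->]] //=.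
  by rewrite ltr01 lexx np subxx leqnn iq orbT.
case: gx gy => /andP[x0 x1] nx sx [/andP[y0 y1] ny sy].
rewrite /good_step /= fn // mulr_gt0 //= mulr_ile1 ?(ltW x0) ?(ltW y0) //=.
apply: fs; case/orP: sx => [->|/andP[np sx]]; case/orP: sy => [->|/andP[nq sy]] //=.
- by rewrite sy orbT.
- by rewrite sx !orbT.
- by rewrite np nq in N.
Qed.

Lemma tprob_good (p : term) : reach_ok p -> all (good_step p) (tprob p).
Proof.
elim/term_ind_all: p => //=.
- move=> s IH /and3P[H1 _ H3]; apply: allI => z.
  move=> H; have [t Ht zt] := In_flatten H; have [x xs Et] := In_map Ht.
  move: zt; rewrite {t Ht}Et.
  have /andP[x0 x1] := allE H1 xs; have ix := allE H3 xs.
  have sx : (tsize x.2 < (foldr (fun x n => tsize x.2 + n) 0 s).+1)%N.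
    by rewrite ltnS tsize_mem.
  have ax := actions_memP xs; have := IH _ xs ix.
  case: ifP => [N _ [<-|//]|_ gx Hz].
    by rewrite /good_step /smaller x0 x1 N ix sx ax.
  have [y ys ->] := In_map Hz; have /and3P[/andP[y0 y1] ny sy] := allE gx ys.
  rewrite /good_step /= mulr_gt0 //= mulr_ile1 ?(ltW x0) ?(ltW y0) // ny /=.
  exact: smallerS sy ax (ltnW sx).
- move=> p IH /IH gp; rewrite all_map; apply: sub_all gp => x /and3P[x0 nx sx].
  by rewrite /good_step /= x0 /nilp size_map -/(nilp _) nx smaller_Theta.
- move=> p q IHp IHq i; have /andP[ip iq] := i.
  apply: good_par; rewrite ?IHp ?IHq //.
    by move=> q1 q2 /= n1 n2; rewrite nilp_par_prob n1.
  by move=> q1 q2; apply: smaller_Par.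
- move=> L p q IHp IHq i; have /and3P[ip iq _] := i.
  apply: good_par; rewrite ?IHp ?IHq //.
    by move=> q1 q2 /= n1 n2; rewrite nilp_par_prob n1.
  by move=> q1 q2; apply: smaller_HPar.
Qed.

Lemma tprob_sum1 (p : term) : reach_ok p -> ~~ nilp (tprob p) -> \sum_(x <- tprob p) x.1 = 1.
Proof.
have par_sum f (q1 q2 : term) : (~~ nilp (tprob q1) -> \sum_(x <- tprob q1) x.1 = 1) ->
    (~~ nilp (tprob q2) -> \sum_(x <- tprob q2) x.1 = 1) ->
    ~~ nilp (par_prob f q1 (tprob q1) q2 (tprob q2)) ->
    \sum_(x <- par_prob f q1 (tprob q1) q2 (tprob q2)) x.1 = 1.
  move=> H1 H2; rewrite nilp_par_prob par_prob_cons => /negPf N; rewrite N.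
  rewrite sum_allpairs; case: ifP => [_|/negbT/H1->]; rewrite ?big_seq1 mul1r;
  by case: ifP => [_|/negbT/H2->] //; rewrite ?big_seq1.
elim/term_ind_all: p => //=.
- move=> s IH /and3P[_ /eqP H2 H3] _; rewrite -[RHS]H2 {H2}.
  rewrite big_flatten /= big_map; elim: s IH H3 => [|x s IHs] IH /=.
    by rewrite !big_nil.
  case/andP=> ix H3; rewrite !big_cons IHs //; last by move=> y ys; apply: IH; right.
  congr (_ + _); case: ifP => [_|/negbT N]; first by rewrite big_seq1.
  rewrite big_map /= -mulr_sumr IH ?mulr1 //; by left.
- move=> p IH /IH; rewrite big_map /= => H; by rewrite /nilp size_map.
- by move=> p q IHp IHq /andP[/IHp Hp /IHq Hq]; apply: par_sum.
- by move=> L p q IHp IHq /and3P[/IHp Hp /IHq Hq _]; apply: par_sum.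
Qed.

Lemma tact_nil (p : term) : ~~ nilp (tprob p) -> tact p = [::].
Proof.
have nn (s : seq (A * term)) : [seq x <- s | false] = [::] by elim: s.
elim/term_ind_all: p => //=.
- by move=> p IH; rewrite /nilp size_map => /IH ->.
- move=> p q IHp IHq; rewrite nilp_par_prob negb_and => /orP[/IHp->//|/IHq->].
  by elim: (tact p).
- move=> L p q IHp IHq; rewrite nilp_par_prob.
  case: (boolP (nilp (tprob p))) => [np|/IHp->] /=.
    move=> N; rewrite (IHq N) (negPf N) /= (eq_filter (a2 := xpred0)) ?nn /=.
      by elim: [seq _ <- _ | _].
    by move=> x; rewrite andbF.
  move=> _; rewrite cats0 (eq_filter (a2 := xpred0)) ?nn // => x.
  by rewrite andbF.
Qed.

Lemma tact_good (p : term) : reach_ok p ->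
  all (fun x => (x.1 \in actions p) && smaller x.2 p) (tact p).
Proof.
elim/term_ind_all: p => //=.
- move=> s IH /andP[_ H]; apply: allI => x xs.
  have /andP[-> a2] := actions_memE xs.
  by rewrite /smaller a2 /= ltnS tsize_mem // (allE H xs).
- move=> p IH /IH H; apply: allI => z Hz.
  have [x Hx ->] := In_map Hz; have [xs _] := In_filter Hx.
  by have /andP[-> ?] := allE H xs; apply: smaller_Theta.
- move=> p q IHp IHq i; have /andP[/IHp Hp /IHq Hq] := i.
  apply: allI => z Hz; have [x [y [xs Hy ->]]] := In_allpairs Hz.
  have [ys _] /= := In_filter Hy.
  have /andP[ax sx] := allE Hp xs; have /andP[_ sy] := allE Hq ys.
  by rewrite inE ax smaller_Par // sx sy.
- move=> L p q IHp IHq i; have /and3P[ip iq _] := i.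
  have Hp := IHp ip; have Hq := IHq iq.
  apply: allI => z Hz; case: (In_cat Hz) => {Hz}[Hz|Hz]; last case: (In_cat Hz) => {}Hz.
  + have [x Hx ->] := In_map Hz; have [xs _] := In_filter Hx; have /andP[ax sx] := allE Hp xs.
    by rewrite /= inE ax smaller_HPar // sx subxx leqnn iq orbT.
  + have [x Hx ->] := In_map Hz; have [xs _] := In_filter Hx; have /andP[ax sx] := allE Hq xs.
    by rewrite /= inE ax orbT smaller_HPar // sx subxx leqnn ip !orbT.
  + have [x [y [Hx Hy ->]]] := In_allpairs Hz.
    have [[xs _] [ys _]] /= := (In_filter Hx, In_filter Hy).
    have /andP[ax sx] := allE Hp xs; have /andP[_ sy] := allE Hq ys.
    by rewrite inE ax smaller_HPar // sx sy.
Qed.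

Lemma labels_filter_map (f : A * term -> term) (a : pred (A * term)) s :
  subseq (unzip1 [seq (x.1, f x) | x <- s & a x]) (unzip1 s).
Proof.
elim: s => //= x s IHs; case: (a x) => /=; first by rewrite eqxx.
exact: subseq_trans IHs (subseq_cons _ _).
Qed.

Lemma labels_sync (f : A * term -> A * term -> term) s (t : seq (A * term)) :
  uniq (unzip1 t) ->
  subseq (unzip1 [seq (x.1, f x y) | x <- s, y <- [seq y <- t | y.1 == x.1]])
    (unzip1 s).
Proof.
move=> ut; elim: s => //= x s IHs.
rewrite /unzip1 map_cat -/(unzip1 _).
have : (size [seq y <- t | y.1 == x.1] <= 1)%N.
  rewrite size_filter -(count_map fst (pred1 x.1)) count_uniq_mem //.
  by case: (_ \in _).
case: [seq y <- t | _] => [|y [|]] //= _; last by rewrite eqxx.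
exact: subseq_trans IHs (subseq_cons _ _).
Qed.

Lemma tact_uniq (p : term) : reach_ok p -> uniq (unzip1 (tact p)).
Proof.
elim/term_ind_all: p => //=.
- by move=> s IH /andP[].
- move=> p IH /IH; apply: subseq_uniq.
  exact: (labels_filter_map (fun x => Theta x.2)).
- move=> p q IHp IHq /andP[/IHp up /IHq uq]; apply: subseq_uniq up.
  exact: (labels_sync (fun x y => Par x.2 y.2)).
- move=> L p q IHp IHq /and3P[ip iq sL].
  have [up uq] := (IHp ip, IHq iq); have gp := tact_good ip; have gq := tact_good iq.
  have up1 := subseq_uniq (labels_filter_map (fun x => HPar L x.2 q) _ (tact p)) up.
  have uq1 := subseq_uniq (labels_filter_map (fun x => HPar L p x.2) _ (tact q)) uq.
  rewrite /unzip1 !map_cat !cat_uniq -!/(unzip1 _) up1 uq1 /=.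
  have us : subseq (unzip1 [seq (x.1, HPar L x.2 y.2)
      | x <- [seq x <- tact p | x.1 \in L], y <- [seq y <- tact q | y.1 == x.1]])
      (unzip1 [seq x <- tact p | x.1 \in L]).
    exact: (labels_sync (fun x y => HPar L x.2 y.2)).
  have inL a : a \in unzip1 [seq (x.1, HPar L x.2 y.2)
      | x <- [seq x <- tact p | x.1 \in L], y <- [seq y <- tact q | y.1 == x.1]] -> a \in L.
    move/(mem_subseq us); elim: (tact p) => //= x s IHs.
    by case: ifP => // xL; rewrite inE => /orP[/eqP->|/IHs].
  have filp (f : A * term -> term) r (b : bool) s a :
      all (fun x => (x.1 \in actions r) && smaller x.2 r) s ->
      a \in unzip1 [seq (x.1, f x) | x <- s & (x.1 \notin L) && b] ->
      (a \in actions r) && (a \notin L).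
    elim: s => //= x s IHs /andP[/andP[ax _] /IHs{}IHs].
    by case: ifP => // /andP[xL _]; rewrite inE => /orP[/eqP->|/IHs //]; rewrite ax.
  apply/and3P; split.
  + rewrite has_cat negb_or; apply/andP; split; apply/hasPn => a.
      move=> /(filp (fun x => HPar L p x.2) q _ _ _ gq)/andP[aq aL].
      apply: contra aL => /(filp (fun x => HPar L x.2 q) p _ _ _ gp)/andP[ap _].
      by apply: (subsetP sL); rewrite inE ap.
    by move=> /inL aL; apply/negP => /(filp (fun x => HPar L x.2 q) p _ _ _ gp)/andP[_]; rewrite aL.
  + apply/hasPn => a /inL aL; apply/negP.
    by move=> /(filp (fun x => HPar L p x.2) q _ _ _ gq)/andP[_]; rewrite aL.
  + apply: subseq_uniq us _; apply: subseq_uniq up.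
    elim: (tact p) => //= x s IHs; case: ifP => _ /=; first by rewrite eqxx.
    exact: subseq_trans IHs (subseq_cons _ _).
Qed.

Lemma reach_inv (p t : term) : reach_ok p -> reachable (T := term_pts) p t -> reach_ok t.
Proof.
move=> ip; elim=> // {}t x _ it xs.
  by have /andP[_ /and3P[]] := allE (tact_good it) xs.
by have /and3P[_ _ /and3P[]] := allE (tprob_good it) xs.
Qed.

Lemma In_catl T (s1 s2 : seq T) y : List.In y s1 -> List.In y (s1 ++ s2).
Proof. by elim: s1 => //= x s IHs [->|/IHs]; [left|right]. Qed.

Lemma In_catr T (s1 s2 : seq T) y : List.In y s2 -> List.In y (s1 ++ s2).
Proof. by elim: s1 => //= x s IHs /IHs; right. Qed.

Lemma reach_fin (p : term) : reach_ok p -> exists l : seq term,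
  forall t, reachable (T := term_pts) p t -> List.In t l.
Proof.
have [n] := ubnP (tsize p); elim: n p => // n IH p; rewrite ltnS => sp ip.
pose succs := unzip2 (tact p) ++ unzip2 (tprob p).
have ok q : List.In q succs -> (tsize q < n)%N && reach_ok q.
  move=> H; case: (In_cat H) => {}H; have [x xs ->] := In_map H.
    have /andP[_ /and3P[_ sx ->]] := allE (tact_good ip) xs.
    by rewrite (leq_trans sx sp).
  have /and3P[_ _ /and3P[_ sx ->]] := allE (tprob_good ip) xs.
  by rewrite (leq_trans sx sp).
have [l Hl] : exists l, forall q t, List.In q succs ->
    reachable (T := term_pts) q t -> List.In t l.
  elim: succs ok => [|q s IHs] ok; first by exists [::].
  have [|l Hl] := IHs; first by move=> r rs; apply: ok; right.
  have /andP[sq iq] := ok q (or_introl erefl).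
  have [l' Hl'] := IH q sq iq.
  exists (l' ++ l) => r t /= [<- /Hl'|rs /(Hl _ _ rs)]; [exact: In_catl|exact: In_catr].
exists (p :: l) => t H.
suff: p = t \/ exists2 q, List.In q succs & reachable (T := term_pts) q t.
  by case=> [->|[q qs /(Hl _ _ qs)]]; [left|right].
elim: H => [|{}t x _ IHt xs|{}t x _ IHt xs]; first by left.
  right; case: IHt => [E|[q qs qt]]; last by exists q => //; apply: reach_act qt xs.
  exists x.2; last exact: reach_refl.
  by apply: In_catl; rewrite E; apply: (List.in_map snd) xs.
right; case: IHt => [E|[q qs qt]]; last by exists q => //; apply: reach_prob qt xs.
exists x.2; last exact: reach_refl.
by apply: In_catr; rewrite E; apply: (List.in_map snd) xs.
Qed.

Lemma csp_is_process (p : term) : csp_process p -> is_process (proc p).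
Proof.
move=> /csp_inv ip; split; first exact: reach_fin.
move=> t /(reach_inv ip) it; split.
- exact: tact_nil.
- exact: tprob_sum1.
- by apply: sub_all (tprob_good it) => x /and3P[H1 H2 _]; rewrite H1.
- exact: tact_uniq.
Qed.

End WellDefined.

(* Main.v *)
(** Multiplying the conditional probabilities along a ready trace gives the
    unconditional probability ([weight]) of that trace, so two processes are
    ready trace equivalent iff they give every trace the same weight.  Weights
    are compositional: the weight of a trace of a composed process is a linear
    (for a binary operator: bilinear) combination of weights of its operands,
    whose coefficients depend only on the trace and on the operator. For
    [HPar], this holds because an action outside L can only come from one of
    the two operands, which is known from the action, and because the other
    operand then stays in a resolved state. *)
Require Import Defs.
From Stdlib Require List.
From mathcomp Require Import all_boot all_order all_algebra ring.

Set Implicit Arguments.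
Unset Strict Implicit.
Unset Printing Implicit Defensive.

Import Order.TTheory GRing.Theory Num.Theory.
Local Open Scope ring_scope.

(** * Sums and membership for lists over types without decidable equality *)

Lemma eq_big_In (V : nmodType) T (s : seq T) (P : pred T) (F G : T -> V) :
  (forall x, List.In x s -> P x -> F x = G x) ->
  \sum_(x <- s | P x) F x = \sum_(x <- s | P x) G x.
Proof.
elim: s => [|x s IHs] H; first by rewrite !big_nil.
rewrite !big_cons IHs; last by move=> y ys; apply: H; right.
by case: ifP => // /(H x (or_introl erefl)) ->.
Qed.

Lemma big_In0 (V : nmodType) T (s : seq T) (P : pred T) (F : T -> V) :
  (forall x, List.In x s -> P x -> F x = 0) -> \sum_(x <- s | P x) F x = 0.
Proof. by move=> /eq_big_In ->; apply: big1. Qed.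

Lemma nilp_flatten T (ss : seq (seq T)) : nilp (flatten ss) = all (@nilp T) ss.
Proof. by elim: ss => //= u ss <-; case: u. Qed.

Lemma hasP_In T (P : pred T) s : has P s <-> exists2 x, List.In x s & P x.
Proof.
elim: s => [|x s IHs] /=; first by split=> [|[]].
split=> [/orP[Px|/IHs[y ys Py]]|[y [->|ys] Py]].
- by exists x; [left|].
- by exists y; [right|].
- by rewrite Py.
- by apply/orP; right; apply/IHs; exists y.
Qed.

(** Determinism: the transitions under one label form a singleton, so [ohead] in [residual] and the
    sum in [nweight] refer to the same successor. *)
Lemma filter_label (T : eqType) U (s : seq (T * U)) y :
  uniq (unzip1 s) -> List.In y s -> [seq x <- s | x.1 == y.1] = [:: y].
Proof.
have memI l : List.In y l -> y.1 \in unzip1 l.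
  by elim: l => //= z l IHl [->|/IHl]; rewrite inE ?eqxx // => ->; rewrite orbT.
elim: s => //= x s IHs /andP[xs us] [E|ys].
  rewrite E eqxx -E; congr (_ :: _); apply/nilP.
  rewrite /nilp size_filter -(count_map fst (pred1 x.1)) -leqn0 leqNgt -has_count.
  by rewrite has_pred1.
by case: eqP xs => [->|_ _]; [rewrite memI|exact: IHs].
Qed.

(** A bilinear expansion found for each pair of successors of two operands stays bilinear after
    summing over all pairs. *)
Lemma sum_bilinear (R : pzSemiRingType) I J K (r : seq I) (s : seq J) (l : seq K)
    (P : pred I) (Q : pred J) (F : K -> I -> R) (G : K -> J -> R) :
  \sum_(i <- r | P i) \sum_(j <- s | Q j) \sum_(u <- l) F u i * G u j =
  \sum_(u <- l) (\sum_(i <- r | P i) F u i) * (\sum_(j <- s | Q j) G u j).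
Proof.
under [RHS]eq_bigr do rewrite mulr_suml.
rewrite [RHS]exchange_big; apply: eq_bigr => i _.
by rewrite exchange_big; apply: eq_bigr => u _; rewrite mulr_sumr.
Qed.

(** * Weights of traces in an arbitrary transition system *)

Section Weights.

Context {A : finType} {R : realFieldType}.
Implicit Types (T : pts A R) (M : {set A}) (a : A).

(** [Step M a t] does not enforce [a \in M]; traces that violate it have weight 0 in every state, by
    [weight_Step_notin]. *)
Inductive trace : Type :=
| Last of {set A}
| Step of {set A} & A & trace.

(** A nondeterministic state counts as a point distribution on itself, so that both kinds of states
    are treated alike. *)
Definition resolve T (s : state T) : seq (R * state T) :=
  if nondet s then [:: (1, s)] else prob s.

(* Meant for nondeterministic states. *)
Fixpoint nweight T (t : trace) (s : state T) : R :=
  match t with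
  | Last M => (menu s == M)%:R
  | Step M a t => (menu s == M)%:R *
      \sum_(y <- act s | y.1 == a) \sum_(x <- resolve y.2) x.1 * nweight t x.2
  end.

Definition weight T (t : trace) (s : state T) : R :=
  \sum_(x <- resolve s) x.1 * nweight t x.2.

Lemma nweight_Step T M a t (s : state T) :
  nweight (Step M a t) s =
  (menu s == M)%:R * \sum_(y <- act s | y.1 == a) weight t y.2.
Proof. by []. Qed.

Lemma weight_nondet T t (s : state T) : nondet s -> weight t s = nweight t s.
Proof. by rewrite /weight /resolve => ->; rewrite big_seq1 mul1r. Qed.

Lemma P1_weight (s : process A R) M : P1 s M = weight (Last M) (Defs.root s).
Proof.
rewrite /P1; case: ifP => n; first by rewrite weight_nondet.
by rewrite /weight /resolve n.
Qed.

Lemma menuE T (s : state T) a : (a \in menu s) = has (fun y => y.1 == a) (act s).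
Proof.
rewrite inE; elim: (act s) => //= y r IHr.
by rewrite inE IHr eq_sym.
Qed.

(** The invariant kept along residuals: with positive probabilities a sum vanishes only termwise,
    and distinct labels make successors unique. *)
Definition well_formed (s : process A R) : Prop :=
  forall t, reachable (Defs.root s) t ->
    all (fun x => (0 < x.1) && nondet x.2) (prob t) /\ uniq (unzip1 (act t)).

Lemma is_process_well_formed s : is_process s -> well_formed s.
Proof.
case=> _ H t /H[_ _ H3 H4]; split=> //.
by apply: sub_all H3 => x /andP[/andP[-> _] ->].
Qed.

Lemma weight_Step_notin T M a t (s : state T) :
  a \notin M -> weight (Step M a t) s = 0.
Proof.
move=> aM; rewrite /weight big1 // => x _; rewrite nweight_Step.
case: eqP => [E|_]; last by rewrite mul0r mulr0.
rewrite big_hasC ?mulr0 // -menuE; by rewrite E.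
Qed.

(** Undefinedness of [Pn] corresponds to weight 0: as all probabilities are positive, a menu whose
    total probability is not positive is not reached at all. *)
Lemma weight_Step_P1_eq0 (s : process A R) M a t : well_formed s ->
  ~~ (0 < P1 s M) -> weight (Step M a t) (Defs.root s) = 0.
Proof.
move=> /(_ _ (reach_refl _))[H _]; rewrite P1_weight.
rewrite /weight /resolve; case: ifP => n.
  rewrite !big_seq1 /=; case: eqP; last by rewrite mul0r mulr0.
  by rewrite mulr1 ltr01.
elim: (prob _) H => [|x r IHr] /=; first by rewrite !big_nil.
case/andP=> /andP[x0 _] /[dup] H /IHr {}IHr; rewrite !big_cons.
have r0 : 0 <= \sum_(j <- r) j.1 * (menu j.2 == M)%:R.
  elim: r H {IHr} => [|y r IHr] /=; first by rewrite big_nil.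
  case/andP=> /andP[y0 _] /IHr{}IHr.
  by rewrite big_cons addr_ge0 // mulr_ge0 ?(ltW y0) ?ler0n.
case: eqP => _; first by rewrite mulr1 ltr_pwDl.
by rewrite !mul0r !mulr0 !add0r.
Qed.

(** * Weights of residual processes *)

Lemma menu_residual T (s : state T) M a t :
  menu (Some t : state (residual_pts s M a)) = menu t.
Proof. by rewrite /menu /= /unzip1 -map_comp. Qed.

Lemma nondet_residual T (s : state T) M a t :
  nondet (Some t : state (residual_pts s M a)) = nondet t.
Proof. by rewrite /nondet /= /nilp size_map. Qed.

(** The new root has no incoming transitions, so nothing changes for the old states. *)
Lemma nweight_residual T (s : state T) M a t u :
  nweight u (Some t : state (residual_pts s M a)) = nweight u t.
Proof.
elim: u t => [N|N b u IHu] t /=; first by rewrite menu_residual.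
rewrite menu_residual big_map /=; congr (_ * _); apply: eq_bigr => y _.
rewrite /resolve nondet_residual; case: ifP => _.
  by rewrite !big_seq1 /= IHu.
by rewrite big_map; apply: eq_bigr => z _; rewrite IHu.
Qed.

Lemma P1_prob T (s : state T) M : ~~ nondet s ->
  P1 (Process s) M = \sum_(x <- prob s | menu x.2 == M) x.1.
Proof.
rewrite /P1 /= => /negPf->; rewrite [RHS]big_mkcond /=.
by apply: eq_bigr => x _; case: eqP => _; rewrite ?mulr1 ?mulr0.
Qed.

Lemma residual_rootP T (s : state T) M a x :
  List.In x (prob (None : state (residual_pts s M a))) ->
  let m := \sum_(y <- prob s | menu y.2 == M) y.1 in
  exists y z, [/\ List.In y (prob s), List.In z (act y.2), reachable s z.2 &
    (nondet z.2 /\ x = (y.1 / m, Some z.2)) \/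
    exists2 v, List.In v (prob z.2) & x = (y.1 * v.1 / m, Some v.2)].
Proof.
move=> xs; have [l Hl xl] := In_flatten xs; have [y Hy El] := In_map Hl.
rewrite {}El in xl; have [l' Hl' xl'] := In_flatten xl.
have [z Hz El'] := In_map Hl'; rewrite {}El' in xl'.
have [[ys _] [zy _]] := (In_filter Hy, In_filter Hz).
exists y, z; split=> //.
  by apply: reach_act zy; apply: reach_prob ys; exact: reach_refl.
case: ifP xl' => nz xl'; first by left; case: xl' => [<-|].
by right; have [v vz ->] := In_map xl'; exists v.
Qed.

Lemma residual_reachable T (s : state T) M a u :
  reachable (None : state (residual_pts s M a)) u ->
  if u is Some t then reachable s t else True.
Proof.
elim=> // {}u x ru IHu.
  case: u ru IHu => [t|] //= _ st xs.
  by have [y ys ->] /= := In_map xs; apply: reach_act ys.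
case: u ru IHu => [t|] _ st xs.
  by have [y ys ->] /= := In_map xs; apply: reach_prob ys.
have [y [z [ys zy sz +]]] := residual_rootP xs.
by case=> [[_ ->]|[v vz ->]] //; apply: reach_prob vz.
Qed.

Lemma residual_pts_well_formed T (s : state T) M a :
  0 < P1 (Process s) M -> ~~ nondet s -> well_formed (Process s) ->
  well_formed (@Process A R (residual_pts s M a) None).
Proof.
move=> + n wf u ru; rewrite P1_prob // => m0; have := residual_reachable ru.
case: u ru => [t|] _ st.
  have [H1 H2] := wf t st; split; last by rewrite /= /unzip1 -map_comp.
  rewrite /= all_map; apply: sub_all H1 => x /=.
  by rewrite nondet_residual.
split=> //; apply: allI => x xs.
have [y [z [ys zy sz +]]] := residual_rootP xs.
have [H1 _] := wf s (reach_refl _); have /andP[y0 _] := allE H1 ys.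
case=> [[nz ->]|[v vz ->]] /=; rewrite nondet_residual.
  by rewrite divr_gt0.
have [H3 _] := wf _ sz; have /andP[v0 nv] := allE H3 vz.
by rewrite divr_gt0 ?mulr_gt0.
Qed.

(** Both sides sum over the same paths; the factor [P1] cancels the divisor [m] that normalises the
    edges of the new root. *)
Lemma residual_prob_weight T (s : state T) M a t :
  a \in M -> 0 < P1 (Process s) M -> ~~ nondet s ->
  weight (Step M a t) s =
  P1 (Process s) M * weight t (None : state (residual_pts s M a)).
Proof.
move=> aM + n; rewrite P1_prob //; move/negPf: n => n.
set m := \sum_(x <- _ | _) _ => P0.
(* The new root is a probabilistic state: since [m] is positive, some [x] has menu [M], which
   contains [a], and its [a]-successor yields an edge. *)
have nN : nondet (None : state (residual_pts s M a)) = false.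
  apply/negbTE; apply: contraL P0.
  rewrite /nondet /= nilp_flatten all_map all_filter /m => H.
  rewrite big_hasC ?ltxx // -all_predC; apply: sub_all H => x /=.
  case: eqP => //= E; rewrite nilp_flatten all_map all_filter.
  have : a \in menu x.2 by rewrite E.
  rewrite menuE => /hasP_In[y ys /= ya] H'; have := allE H' ys; rewrite /= ya /=.
  by case: (boolP (nondet y.2)) => //; rewrite /nondet; case: (prob y.2).
rewrite /weight /resolve n nN /= -/m big_flatten /= big_map big_filter.
rewrite mulr_sumr [RHS]big_mkcond /=; apply: eq_bigr => x _.
case: eqP => _; last by rewrite mul0r mulr0.
rewrite mul1r big_flatten /= big_map big_filter !mulr_sumr.
apply: eq_bigr => y _; rewrite /resolve.
have m0 : m != 0 by rewrite gt_eqF.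
case: ifP => _.
  by rewrite !big_seq1 /= nweight_residual; field.
rewrite big_map !mulr_sumr; apply: eq_bigr => z _ /=.
by rewrite nweight_residual; field.
Qed.

(** Chain rule: conditioning on the first menu splits off the factor [P1]. For a nondeterministic
    root this factor is 1 and the residual is the unique [a]-successor. *)
Lemma residual_weight (s : process A R) M a :
  well_formed s -> a \in M -> 0 < P1 s M ->
  exists2 r, residual s M a = Some r & well_formed r /\
    forall t, weight (Step M a t) (Defs.root s) = P1 s M * weight t (Defs.root r).
Proof.
case: s => T s /= wf aM P0; rewrite /residual /= aM /=; case: ifP => n.
  move: P0; rewrite /P1 /= n; case: eqP => [E|]; last by rewrite ltxx.
  move=> _; have [_] := wf s (reach_refl _).
  have : a \in menu s by rewrite E.
  rewrite menuE => /hasP_In[y ys /eqP ya] u.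
  have Ef := filter_label u ys; rewrite ya in Ef.
  rewrite Ef /=; exists (Process y.2) => //; split=> [t|t].
    move=> /= yt; apply: wf => /=; elim: yt => [|w x _ sw wx|w x _ sw wx].
    - exact: reach_act (reach_refl _) ys.
    - exact: reach_act sw wx.
    - exact: reach_prob sw wx.
  rewrite weight_nondet // nweight_Step E eqxx -big_filter Ef big_seq1 //.
have : has (fun x => menu x.2 == M) (prob s).
  by apply: contraLR P0; rewrite P1_prob ?n // => h; rewrite big_hasC ?ltxx.
move=> ->; exists (@Process A R (residual_pts s M a) None) => //.
split=> [|t]; first by apply: residual_pts_well_formed; rewrite ?n.
by apply: residual_prob_weight; rewrite ?n.
Qed.

(** Induction on the trace, for all pairs of processes at once since residuals change the underlying
    system. The chain rule and cancellation of the positive first factor translate between [Pn] and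
    weights. *)
Lemma ready_equiv_weight (s s' : process A R) :
  well_formed s -> well_formed s' ->
  ready_equiv s s' <-> forall t, weight t (Defs.root s) = weight t (Defs.root s').
Proof.
move=> wf wf'; split=> [H t|H h].
  elim: t s s' wf wf' H => [M|M a t IHt] s s' wf wf' H.
    by have [] := H [::] M isT; rewrite !P1_weight.
  have [EP] := H [::] M isT.
  case: (boolP (a \in M)) => aM; last by rewrite !weight_Step_notin.
  case: (boolP (0 < P1 s M)) => P0; last by rewrite !weight_Step_P1_eq0 -?EP.
  have [r Er [wr Hr]] := residual_weight wf aM P0.
  have P0' : 0 < P1 s' M by rewrite -EP.
  have [r' Er' [wr' Hr']] := residual_weight wf' aM P0'.
  rewrite Hr Hr' EP (IHt r r') // => h N rh.
  by have := H ((M, a) :: h) N; rewrite /= P0 P0' Er Er' /= aM; apply.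
elim: h s s' wf wf' H => [|[M a] h IHh] s s' wf wf' H N /=.
  by rewrite !P1_weight H.
case/andP=> aM rh; have EP : P1 s M = P1 s' M by rewrite !P1_weight H.
rewrite -EP; case: ifP => // P0.
have [r -> [wr Hr]] := residual_weight wf aM P0.
have P0' : 0 < P1 s' M by rewrite -EP.
have [r' -> [wr' Hr']] := residual_weight wf' aM P0'.
apply: IHh => // t; apply: (mulfI (lt0r_neq0 P0)).
by rewrite -Hr EP -Hr' H.
Qed.

End Weights.

Arguments trace : clear implicits.

(** * Weights of terms and of the two choices *)

Section Congruence.

Context {d : Order.disp_t} {A : finPOrderType d} {R : realFieldType}.
Notation term := (term A R).
Notation pmenu p := (@menu A R term_pts p).
Notation pweight t p := (@weight A R term_pts t p).
Notation pnweight t p := (@nweight A R term_pts t p).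
Notation presolve p := (@resolve A R term_pts p).

Lemma presolveE (p : term) :
  presolve p = if nilp (tprob p) then [:: (1, p)] else tprob p.
Proof. by []. Qed.

Lemma resolve_good (p : term) x : reach_ok p -> List.In x (presolve p) ->
  [/\ nilp (tprob x.2), reach_ok x.2 & actions x.2 \subset actions p].
Proof.
move=> ip; rewrite presolveE; case: ifP => n; first by case=> [<-|].
by move=> /(allE (tprob_good ip))/and3P[_ -> /and3P[-> _ ->]].
Qed.

(** The empty choice is excluded: without transitions it is nondeterministic with empty menu, so its
    weight need not be the empty sum. *)
Lemma weight_ProbChoice t (s : seq (R * term)) : ~~ nilp s ->
  pweight t (ProbChoice s) = \sum_(x <- s) x.1 * pweight t x.2.
Proof.
move=> s0.
have -> : pweight t (ProbChoice s) = \sum_(y <- flatten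
    [seq [seq (x.1 * y.1, y.2) | y <- presolve x.2] | x <- s]) y.1 * pnweight t y.2.
  rewrite /weight presolveE [X in nilp X]/= nilp_flatten all_map.
  rewrite ifF; last by case: s s0 => //= x s _; case: ifP => //; rewrite /nilp size_map => ->.
  congr (\sum_(y <- flatten _) _); apply: eq_map => -[r x] /=; rewrite presolveE.
  by case: ifP => //= _; rewrite mulr1.
rewrite big_flatten /= big_map; apply: eq_bigr => x _; rewrite big_map mulr_sumr.
by apply: eq_bigr => y _; rewrite mulrA.
Qed.

Lemma weight_ExtChoice t (s : seq (A * term)) :
  pweight t (ExtChoice s) = pnweight t (ExtChoice s).
Proof. exact: weight_nondet. Qed.

(** * The priority operator *)

(** [Theta] acts on each probabilistic target separately, so a linear relation lifts from [nweight]
    to [weight]. *)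
Lemma weight_Theta_nweight t (l : seq (trace A)) (p : term) :
  (forall x : term, pnweight t (Theta x) = \sum_(u <- l) pnweight u x) ->
  pweight t (Theta p) = \sum_(u <- l) pweight u p.
Proof.
move=> H; rewrite /weight exchange_big /=.
rewrite !presolveE /= /nilp size_map -/(nilp _); case: ifP => _.
  rewrite !big_seq1 H mulr_sumr; apply: eq_bigr => u _.
  by rewrite mul1r.
by rewrite big_map; apply: eq_bigr => x _; rewrite H mulr_sumr.
Qed.

(** The effect of priority on a menu. It depends on the menu alone, which makes the weights of
    [Theta p] computable from those of [p]. *)
Definition maximals (N : {set A}) := [set a in N | [forall b in N, ~~ (a < b)%O]].

Lemma pmenu_top (x : term) a : a \in pmenu x ->
  ~~ has (fun y => (a < y.1)%O) (tact x) = (a \in maximals (pmenu x)).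
Proof.
move=> ax; rewrite inE ax -(has_map fst (fun b => (a < b)%O)).
by apply/hasPn/forall_inP => H b; have := H b; rewrite inE.
Qed.

Lemma pmenu_Theta (x : term) : pmenu (Theta x) = maximals (pmenu x).
Proof.
apply/setP => a; rewrite [LHS]inE /= /unzip1 -map_comp.
rewrite -[X in a \in X]/(map fst _).
rewrite -(filter_map fst (fun b => ~~ has (fun y => (b < y.1)%O) (tact x))).
have E : (a \in map fst (tact x)) = (a \in pmenu x) by rewrite inE.
rewrite mem_filter E; case: (boolP (a \in pmenu x)) => ax.
  by rewrite andbT pmenu_top.
by rewrite andbF [RHS]inE (negPf ax).
Qed.

Lemma sum_tact_Theta (F : term -> R) (x : term) a :
  \sum_(z <- tact (Theta x) | z.1 == a) F z.2 =
  (a \in maximals (pmenu x))%:R * \sum_(z <- tact x | z.1 == a) F (Theta z.2).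
Proof.
rewrite /= big_map big_filter_cond /= mulr_sumr.
rewrite big_mkcond [RHS]big_mkcond /=; apply: eq_big_In => y ys _.
case: eqP => [<-|]; last by rewrite andbF.
rewrite andbT pmenu_top; first by case: (_ \in _); rewrite ?mul1r ?mul0r.
by rewrite menuE; apply/hasP_In; exists y.
Qed.

(** Turns a condition on the menu [B] into a combination of tests for single menus, the form in
    which menus enter weights. *)
Lemma sum_menu (P : pred {set A}) (B : {set A}) (F : R) :
  (P B)%:R * F = \sum_(N <- enum {set A} | P N) (B == N)%:R * F.
Proof.
rewrite big_enum_cond /= big_mkcond /= (bigD1 B) //= !eqxx !mul1r.
rewrite big1 ?addr0; first by case: (P B); rewrite ?mul1r ?mul0r.
by move=> N /negPf; rewrite eq_sym => ->; rewrite mul0r; case: (P N).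
Qed.

(** A trace of [Theta p] arises from the traces of [p] whose menus have the observed menus as their
    sets of maximal actions. *)
Lemma weight_Theta t :
  exists l : seq (trace A), forall p : term,
    pweight t (Theta p) = \sum_(u <- l) pweight u p.
Proof.
suff [l Hl] : exists l : seq (trace A), forall x : term,
    pnweight t (Theta x) = \sum_(u <- l) pnweight u x.
  by exists l => p; apply: weight_Theta_nweight.
elim: t => [M|M a t [l IHl]].
  exists [seq Last N | N <- enum {set A} & maximals N == M] => x.
  rewrite big_map big_filter /= pmenu_Theta -[LHS]mulr1.
  rewrite (sum_menu (fun N => maximals N == M)).
  by apply: eq_bigr => N _; rewrite mulr1.
(* A step by [a] survives priority only if [a] is in the observed menu, hence the test [a \in M]. *)
exists [seq Step N a u
  | N <- [seq N <- enum {set A} | (maximals N == M) && (a \in M)], u <- l] => x.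
rewrite nweight_Step pmenu_Theta big_allpairs_dep big_filter sum_tact_Theta /=.
rewrite mulrA -natrM mulnb.
under eq_bigr do rewrite (weight_Theta_nweight _ IHl).
have -> : (maximals (pmenu x) == M) && (a \in maximals (pmenu x)) =
          (maximals (pmenu x) == M) && (a \in M) by case: eqP => [->|].
rewrite exchange_big mulr_sumr exchange_big /=; apply: eq_bigr => u _.
exact: (sum_menu (fun N => (maximals N == M) && (a \in M))).
Qed.

(** * Synchronous composition *)

Lemma sum_sync (f : term -> term -> term) (s r : seq (A * term)) a (F : term -> R) :
  \sum_(z <- [seq (x.1, f x.2 y.2) | x <- s,
                y <- [seq y <- r | y.1 == x.1]] | z.1 == a) F z.2 =
  \sum_(x <- s | x.1 == a) \sum_(y <- r | y.1 == a) F (f x.2 y.2) :> R.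
Proof.
rewrite big_mkcond big_allpairs_dep [RHS]big_mkcond /=; apply: eq_bigr => x _.
rewrite big_filter; case: eqP => [->|_] //; by rewrite big1.
Qed.

Lemma labels_syncE (f : term -> term -> term) (s r : seq (A * term)) a :
  (a \in unzip1 [seq (x.1, f x.2 y.2) | x <- s, y <- [seq y <- r | y.1 == x.1]]) =
  (a \in unzip1 s) && (a \in unzip1 r).
Proof.
elim: s => //= x s IHs; rewrite /unzip1 map_cat -map_comp mem_cat -!/(unzip1 _) IHs inE.
rewrite andb_orl; congr (_ || _).
elim: r {s IHs} => [|y r IHr] /=; first by rewrite andbF.
rewrite inE; case: (eqVneq y.1 x.1) => [->|ne] /=; rewrite ?inE IHr.
  by case: eqP.
by case: (eqVneq a x.1) => //= ->; rewrite eq_sym (negPf ne).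
Qed.

(** With a resolved operand counted as a point distribution, the operands resolve independently and
    probabilities multiply. The hypothesis concerns resolved pairs only, because the interleaving
    steps of [HPar] require an idle operand to be resolved. *)
Lemma weight_par_nweight (f : term -> term -> term) p q t l :
  tprob (f p q) = par_prob f p (tprob p) q (tprob q) ->
  (forall x y, List.In x (presolve p) -> List.In y (presolve q) ->
    pnweight t (f x.2 y.2) = \sum_(u <- l) pnweight u.1 x.2 * pnweight u.2 y.2) ->
  pweight t (f p q) = \sum_(u <- l) pweight u.1 p * pweight u.2 q.
Proof.
move=> E H; rewrite [LHS]/weight.
have -> : presolve (f p q) =
   [seq (x.1 * y.1, f x.2 y.2) | x <- presolve p, y <- presolve q].
  rewrite !presolveE E nilp_par_prob par_prob_cons.
  by case: ifP => [/andP[-> ->]|->] //=; rewrite mulr1.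
rewrite big_allpairs_dep /=.
rewrite /weight -sum_bilinear.
apply: eq_big_In => x xs _; apply: eq_big_In => y ys _; rewrite H // mulr_sumr.
by apply: eq_bigr => u _; apply: mulrACA.
Qed.

Lemma sum_menus (c : {set A} -> {set A} -> {set A}) M (B C : {set A}) (F G : R) :
  (c B C == M)%:R * (F * G) =
  \sum_(N <- enum {: {set A} * {set A}} | c N.1 N.2 == M)
    ((B == N.1)%:R * F) * ((C == N.2)%:R * G).
Proof.
rewrite big_enum_cond /= big_mkcond /= (bigD1 (B, C)) //= !eqxx !mul1r.
rewrite big1 ?addr0; first by case: eqP => _; rewrite ?mul1r ?mul0r.
case=> N N' /= ne; case: ifP => // _; move: ne; rewrite xpair_eqE negb_and.
by case/orP => /negPf; rewrite eq_sym => ->; rewrite !mul0r ?mulr0.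
Qed.

Lemma weight_Par t :
  exists l : seq (trace A * trace A), forall p q : term,
    pweight t (Par p q) = \sum_(u <- l) pweight u.1 p * pweight u.2 q.
Proof.
suff [l Hl] : exists l : seq (trace A * trace A), forall x y : term,
    pnweight t (Par x y) = \sum_(u <- l) pnweight u.1 x * pnweight u.2 y.
  by exists l => p q; apply: weight_par_nweight.
have menuP (x y : term) : pmenu (Par x y) = pmenu x :&: pmenu y.
  by apply/setP => a; rewrite !inE labels_syncE.
elim: t => [M|M a t [l IHl]].
  exists [seq (Last N.1, Last N.2)
    | N <- enum {: {set A} * {set A}} & N.1 :&: N.2 == M] => x y.
  rewrite big_map big_filter /= menuP -[LHS]mulr1 -[X in _ * X = _]mulr1 (sum_menus (@setI A)).
  by apply: eq_bigr => N _; rewrite !mulr1.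
(* Both operands take [a], starting from any two menus whose intersection is [M]. *)
exists [seq (Step N.1 a u.1, Step N.2 a u.2)
  | N <- [seq N <- enum {: {set A} * {set A}} | N.1 :&: N.2 == M], u <- l] => x y.
rewrite nweight_Step menuP big_allpairs_dep /= big_filter.
have -> : \sum_(z <- tact (Par x y) | z.1 == a) pweight t z.2 =
   \sum_(u <- l) (\sum_(z <- tact x | z.1 == a) pweight u.1 z.2) *
                 (\sum_(z <- tact y | z.1 == a) pweight u.2 z.2).
  rewrite sum_sync.
  transitivity (\sum_(x' <- tact x | x'.1 == a) \sum_(y' <- tact y | y'.1 == a)
      \sum_(u <- l) pweight u.1 x'.2 * pweight u.2 y'.2).
    by apply: eq_bigr => x' _; apply: eq_bigr => y' _; apply: weight_par_nweight.
  exact: sum_bilinear.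
rewrite mulr_sumr exchange_big /=; apply: eq_bigr => u _.
exact: (sum_menus (@setI A)).
Qed.

(** * Composition synchronising on [L] *)

Definition hpar_menu (L N N' : {set A}) : {set A} :=
  (N :\: L) :|: (N' :\: L) :|: (N :&: N' :&: L).

Lemma pmenu_HPar L (x y : term) : nilp (tprob x) -> nilp (tprob y) ->
  pmenu (HPar L x y) = hpar_menu L (pmenu x) (pmenu y).
Proof.
move=> nx ny; apply/setP => a; rewrite !inE /= nx ny.
rewrite /unzip1 !map_cat !mem_cat -!/(unzip1 _) labels_syncE -orbA.
have E (f : A * term -> term) (s : seq (A * term)) :
    (a \in unzip1 [seq (x.1, f x) | x <- s & (x.1 \notin L) && true]) =
    (a \notin L) && (a \in unzip1 s).
  rewrite -[RHS](mem_filter (fun b => b \notin L)).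
  rewrite /unzip1 -map_comp filter_map; congr (_ \in map _ _).
  by apply: eq_filter => z; rewrite /= andbT.
rewrite (E (fun z => HPar L z.2 y) (tact x)) (E (fun z => HPar L x z.2) (tact y)).
have E' (s : seq (A * term)) :
    (a \in unzip1 [seq z <- s | z.1 \in L]) = (a \in L) && (a \in unzip1 s).
  rewrite -[RHS](mem_filter (fun b => b \in L)).
  by rewrite /unzip1 filter_map.
by rewrite E'; case: (a \in L); rewrite /= ?andbT ?andbF ?orbF.
Qed.

Lemma sum_tact_HPar (F : term -> R) L (x y : term) a :
  nilp (tprob x) -> nilp (tprob y) ->
  \sum_(z <- tact (HPar L x y) | z.1 == a) F z.2 =
  if a \in L then
    \sum_(x' <- tact x | x'.1 == a) \sum_(y' <- tact y | y'.1 == a) F (HPar L x'.2 y'.2)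
  else \sum_(x' <- tact x | x'.1 == a) F (HPar L x'.2 y) +
       \sum_(y' <- tact y | y'.1 == a) F (HPar L x y'.2).
Proof.
move=> nx ny; rewrite /= nx ny !big_cat /= sum_sync !big_map !big_filter_cond /=.
have E (s : seq (A * term)) (G : A * term -> R) :
    \sum_(z <- s | ((z.1 \notin L) && true) && (z.1 == a)) G z =
    (a \notin L)%:R * \sum_(z <- s | z.1 == a) G z.
  rewrite mulr_sumr big_mkcond [RHS]big_mkcond; apply: eq_bigr => z _ /=.
  by case: eqP => [->|_]; rewrite ?andbT ?andbF ?mulr0 //;
    case: (a \in L); rewrite ?mul1r ?mul0r.
have E' (s : seq (A * term)) (G : A * term -> R) :
    \sum_(z <- s | (z.1 \in L) && (z.1 == a)) G z =
    (a \in L)%:R * \sum_(z <- s | z.1 == a) G z.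
  rewrite mulr_sumr big_mkcond [RHS]big_mkcond; apply: eq_bigr => z _ /=.
  by case: eqP => [->|_]; rewrite ?andbT ?andbF ?mulr0 //;
    case: (a \in L); rewrite ?mul1r ?mul0r.
rewrite !E E'; case: (a \in L) => /=; first by rewrite !mul0r !add0r mul1r.
by rewrite !mul1r mul0r addr0.
Qed.

Definition first (t : trace A) := match t with Last M | Step M _ _ => M end.

(** A trace has weight 0 in a state unless its first menu is the menu of the state, so either test
    may replace the other. *)
Lemma nweight_first t (s : term) M :
  (first t == M)%:R * pnweight t s = (pmenu s == M)%:R * pnweight t s.
Proof.
case: t => [N|N a t] /=; have [->|] := eqVneq (menu _) N; rewrite ?mul0r ?mulr0 //.
Qed.

(* The actions outside L are split once and for all: those in B can only be
   done by the right operand, the others only by the left one.  B depends on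
   the operand that is not in the hole. *)
Definition hpar_ok (L B : {set A}) (p q : term) :=
  [&& reach_ok p, reach_ok q, actions p :&: B \subset L & actions q \subset B :|: L].

Lemma hpar_ok_mono L B p q p' q' : hpar_ok L B p q ->
  reach_ok p' -> actions p' \subset actions p ->
  reach_ok q' -> actions q' \subset actions q -> hpar_ok L B p' q'.
Proof.
case/and4P=> _ _ Hp Hq rp sp rq sq; rewrite /hpar_ok rp rq /=.
by rewrite (subset_trans (setSI _ sp) Hp) (subset_trans sq Hq).
Qed.

Lemma tact_step (p : term) z : reach_ok p -> List.In z (tact p) ->
  [/\ z.1 \in actions p, reach_ok z.2 & actions z.2 \subset actions p].
Proof. by move=> rp /(allE (tact_good rp))/andP[-> /and3P[-> _ ->]]. Qed.

Lemma weight_HPar_nweight t L B l (p q : term) :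
  (forall x y : term, hpar_ok L B x y -> nilp (tprob x) -> nilp (tprob y) ->
    pnweight t (HPar L x y) = \sum_(u <- l) pnweight u.1 x * pnweight u.2 y) ->
  hpar_ok L B p q ->
  pweight t (HPar L p q) = \sum_(u <- l) pweight u.1 p * pweight u.2 q.
Proof.
move=> H ok; have /and4P[rp rq _ _] := ok.
apply: weight_par_nweight => // x y xs ys.
have [nx rx sx] := resolve_good rp xs; have [ny ry sy] := resolve_good rq ys.
by apply: H => //; apply: hpar_ok_mono ok _ _ _ _.
Qed.

Lemma weight_HPar t L B :
  exists l : seq (trace A * trace A), forall p q : term, hpar_ok L B p q ->
    pweight t (HPar L p q) = \sum_(u <- l) pweight u.1 p * pweight u.2 q.
Proof.
suff [l Hl] : exists l : seq (trace A * trace A), forall x y : term,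
    hpar_ok L B x y -> nilp (tprob x) -> nilp (tprob y) ->
    pnweight t (HPar L x y) = \sum_(u <- l) pnweight u.1 x * pnweight u.2 y.
  by exists l => p q; apply: weight_HPar_nweight.
elim: t => [M|M a t [l /weight_HPar_nweight IHl]].
  exists [seq (Last N.1, Last N.2)
    | N <- enum {: {set A} * {set A}} & hpar_menu L N.1 N.2 == M] => x y _ nx ny.
  rewrite big_map big_filter /= pmenu_HPar // -[LHS]mulr1 -[X in _ * X = _]mulr1.
  rewrite (sum_menus (hpar_menu L)).
  by apply: eq_bigr => N _; rewrite !mulr1.
pose Ns := [seq N <- enum {: {set A} * {set A}} | hpar_menu L N.1 N.2 == M].
case: (boolP (a \in L)) => aL.
  exists [seq (Step N.1 a u.1, Step N.2 a u.2) | N <- Ns, u <- l] => x y ok nx ny.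
  have /and4P[rx ry _ _] := ok.
  rewrite nweight_Step pmenu_HPar // big_allpairs_dep big_filter sum_tact_HPar // aL.
  have -> : \sum_(x' <- tact x | x'.1 == a) \sum_(y' <- tact y | y'.1 == a)
       pweight t (HPar L x'.2 y'.2) =
     \sum_(u <- l) (\sum_(z <- tact x | z.1 == a) pweight u.1 z.2) *
                   (\sum_(z <- tact y | z.1 == a) pweight u.2 z.2).
    rewrite -sum_bilinear; apply: eq_big_In => x' xs _; apply: eq_big_In => y' ys _.
    have [_ rx' sx'] := tact_step rx xs; have [_ ry' sy'] := tact_step ry ys.
    by apply: IHl; apply: hpar_ok_mono ok _ _ _ _.
  rewrite mulr_sumr exchange_big /=; apply: eq_bigr => u _.
  exact: (sum_menus (hpar_menu L)).
case: (boolP (a \in B)) => aB.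
  (* Only the right operand moves. The left one is idle and keeps its menu, so its trace [u.1] gets
     no new step and must start with [N.1]. *)
  exists [seq (u.1, Step N.2 a u.2) | N <- Ns, u <- [seq u <- l | first u.1 == N.1]].
  move=> x y ok nx ny; have /and4P[rx ry Hx _] := ok.
  rewrite nweight_Step pmenu_HPar // big_allpairs_dep big_filter sum_tact_HPar //.
  rewrite (negPf aL) [X in X + _]big_In0 ?add0r; last first.
    move=> x' /(tact_step rx)[ax _ _] /eqP E.
    by case/negP: aL; apply: (subsetP Hx); rewrite -E inE ax E.
  have -> : \sum_(y' <- tact y | y'.1 == a) pweight t (HPar L x y'.2) =
     \sum_(u <- l) pnweight u.1 x * (\sum_(z <- tact y | z.1 == a) pweight u.2 z.2).
    under [RHS]eq_bigr do rewrite mulr_sumr.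
    rewrite exchange_big; apply: eq_big_In => y' ys _.
    have [_ ry' sy'] := tact_step ry ys.
    rewrite IHl ?(hpar_ok_mono ok) //; apply: eq_bigr => u _.
    by rewrite weight_nondet.
  rewrite mulr_sumr (eq_bigr _ (fun u _ => sum_menus (hpar_menu L) M _ _ _ _)).
  rewrite exchange_big; apply: eq_bigr => N _ /=.
  rewrite big_filter [RHS]big_mkcond; apply: eq_bigr => u _.
  (* The menu test of the idle operand becomes the filter on [first u.1]. *)
  by rewrite -nweight_first; case: (first _ == _); rewrite ?mul1r ?mul0r.
(* Symmetric case: [a] lies outside both [L] and [B], so only the left operand moves. *)
exists [seq (Step N.1 a u.1, u.2) | N <- Ns, u <- [seq u <- l | first u.2 == N.2]].
move=> x y ok nx ny; have /and4P[rx ry _ Hy] := ok.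
rewrite nweight_Step pmenu_HPar // big_allpairs_dep big_filter sum_tact_HPar //.
rewrite (negPf aL) [X in _ + X]big_In0 ?addr0; last first.
  move=> y' /(tact_step ry)[ay _ _] /eqP E.
  by have := subsetP Hy _ ay; rewrite E inE (negPf aB) (negPf aL).
have -> : \sum_(x' <- tact x | x'.1 == a) pweight t (HPar L x'.2 y) =
   \sum_(u <- l) (\sum_(z <- tact x | z.1 == a) pweight u.1 z.2) * pnweight u.2 y.
  under [RHS]eq_bigr do rewrite mulr_suml.
  rewrite exchange_big; apply: eq_big_In => x' xs _.
  have [_ rx' sx'] := tact_step rx xs.
  rewrite IHl ?(hpar_ok_mono ok) //; apply: eq_bigr => u _.
  by rewrite [pweight u.2 y]weight_nondet.
rewrite mulr_sumr (eq_bigr _ (fun u _ => sum_menus (hpar_menu L) M _ _ _ _)).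
rewrite exchange_big; apply: eq_bigr => N _ /=.
rewrite big_filter [RHS]big_mkcond; apply: eq_bigr => u _.
by rewrite -nweight_first; case: (first _ == _); rewrite ?mul1r ?mul0r ?mulr0.
Qed.

(** * Congruence for contexts *)

Lemma weight_ExtChoice_congr s1 s2 a (p q : term) t :
  (forall u, pweight u p = pweight u q) ->
  pweight t (ExtChoice (s1 ++ (a, p) :: s2)) =
  pweight t (ExtChoice (s1 ++ (a, q) :: s2)).
Proof.
move=> H; rewrite !weight_ExtChoice.
have E : pmenu (ExtChoice (s1 ++ (a, p) :: s2)) =
         pmenu (ExtChoice (s1 ++ (a, q) :: s2)).
  by rewrite /menu /= /unzip1 !map_cat.
case: t => [M|M b t]; first by rewrite /= E.
rewrite !nweight_Step E; congr (_ * _).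
by rewrite /= !big_cat !big_cons /= H.
Qed.

(** Induction on the context: each operator expands with the same coefficients for both fillings, so
    equal weights of the operands suffice. *)
Lemma weight_fill (C : context A R) (p q : term) :
  (forall t, pweight t p = pweight t q) ->
  csp_process (fill C p) -> csp_process (fill C q) ->
  forall t, pweight t (fill C p) = pweight t (fill C q).
Proof.
move=> H.
have catE B (s1 s2 : seq (B * term)) b (r : term) :
    all (fun x => csp_process x.2) (s1 ++ (b, r) :: s2) -> csp_process r.
  by rewrite all_cat => /andP[_] /andP[].
elim: C => [|s1 a C IH s2|s1 r C IH s2|C IH|C IH r|r C IH|L C IH r|L r C IH] //=.
- move=> /andP[_ Hp] /andP[_ Hq] t.
  by apply: weight_ExtChoice_congr; apply: IH; [exact: catE Hp|exact: catE Hq].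
- move=> /and3P[_ _ Hp] /and3P[_ _ Hq] t.
  have n r' : ~~ nilp (s1 ++ (r, r') :: s2) by rewrite /nilp size_cat addnS.
  by rewrite !weight_ProbChoice // !big_cat !big_cons /= IH //; [exact: catE Hp|exact: catE Hq].
- move=> Hp Hq t; have [l Hl] := weight_Theta t.
  by rewrite !Hl; apply: eq_bigr => u _; apply: IH.
- move=> /andP[Hp _] /andP[Hq _] t; have [l Hl] := weight_Par t.
  by rewrite !Hl; apply: eq_bigr => u _; rewrite IH.
- move=> /andP[_ Hp] /andP[_ Hq] t; have [l Hl] := weight_Par t.
  by rewrite !Hl; apply: eq_bigr => u _; rewrite IH.
- move=> /and4P[Hp Hr /eqP Lp _] /and4P[Hq _ /eqP Lq _] t.
  (* [r] is the right operand, and every action it shares with the filled hole is in [L]. This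
     choice of [B] depends on [r] alone, so one list serves both fillings. *)
  have [l Hl] := weight_HPar t L (actions r).
  rewrite !Hl; first by apply: eq_bigr => u _; rewrite IH.
    by rewrite /hpar_ok !csp_inv // -Lq subxx subsetUl.
  by rewrite /hpar_ok !csp_inv // -Lp subxx subsetUl.
- move=> /and4P[Hr Hp /eqP Lp _] /and4P[_ Hq /eqP Lq _] t.
  (* Now [r] is on the left, so the complement of its actions is assigned to the right operand. *)
  have [l Hl] := weight_HPar t L (~: actions r).
  rewrite !Hl; first by apply: eq_bigr => u _; rewrite IH.
    by rewrite /hpar_ok !csp_inv // setICr sub0set Lq setUIr setUC setUCr setTI subsetUr.
  by rewrite /hpar_ok !csp_inv // setICr sub0set Lp setUIr setUC setUCr setTI subsetUr.
Qed.

End Congruence.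

Theorem theorem1 (d : Order.disp_t) (A : finPOrderType d) (R : realFieldType)
    (p pbar : term A R)
    (hp : csp_process p) (hpbar : csp_process pbar)
    (hequiv : ready_equiv (proc p) (proc pbar))
    (C : context A R)
    (hC : csp_process (fill C p)) (hCbar : csp_process (fill C pbar)) :
  ready_equiv (proc (fill C p)) (proc (fill C pbar)).
Proof.
have wf (q : term A R) : csp_process q -> well_formed (proc q).
  by move=> /csp_is_process/is_process_well_formed.
apply/(ready_equiv_weight (wf _ hC) (wf _ hCbar)).
apply: weight_fill hC hCbar.
exact/(ready_equiv_weight (wf p hp) (wf pbar hpbar)).
Qed.
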